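(* Let $0\le k\le n<\infty$ be integers and let $m_1\ge m_2$ be integers such that the complex algebra $A=\mathrm{IDD}(K^k_n,m_1,m_2)$ has nonzero multiplication. If its level $\mathrm{lev}(A)=m_1+m_2$ satisfies $n<m_1+m_2\le 2n-k$, then $A$ is nilpotent.
   Context: For an integer $m$ and an integer $i\ge 0$ put $c_m(i)=\frac{i!}{(i-m)!}$ if $i\ge m$ and $c_m(i)=0$ if $i<m$ (so $T^m(x^i)=c_m(i)x^{i-m}$, where $T^m$ is the $m$-th derivative for $m>0$, the identity for $m=0$, and the $|m|$-fold iterate of $\int x^i=\frac{1}{i+1}x^{i+1}$ for $m<0$). The algebra $\mathrm{IDD}(K^k_n,m_1,m_2)$ is the complex algebra with basis $e_k,e_{k+1},\ldots,e_n$ and bilinear multiplication $e_i\diamond e_j=c_{m_1}(i)\,c_{m_2}(j)\,e_{i+j-m_1-m_2}$ if $k\le i+j-m_1-m_2\le n$, and $e_i\diamond e_j=0$ otherwise. Its level is $m_1+m_2$. A (non-associative) algebra $A$ is nilpotent if $A^{t}=0$ for some $t$, where $A^1=A$ and $A^{t}=\sum_{i+j=t}A^{i}\diamond A^{j}$ ($i,j\ge1$). *)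

(* Defs.v *)
From mathcomp Require Import all_boot all_order all_algebra.
From mathcomp Require Export complex reals.

Set Implicit Arguments.
Unset Strict Implicit.
Unset Printing Implicit Defensive.

Import GRing.Theory Num.Theory.
Local Open Scope ring_scope.

Section NonassociativePowers.
Variables (K : fieldType) (V : lmodType K) (mul : V -> V -> V).

(* [alg_pow t x] says that x lies in A^t, where A is the vector space V with
   the product mul: A^1 = A, and A^t is the linear span of the products x * y
   with x in A^i, y in A^j, i + j = t and i, j >= 1.  The degenerate power A^0,
   which the mathematics does not use, comes out as {0}. *)
Inductive alg_pow : nat -> V -> Prop :=
| alg_pow_one x : alg_pow 1 x
| alg_pow_mul i j x y : (0 < i)%N -> (0 < j)%N ->
    alg_pow i x -> alg_pow j y -> alg_pow (i + j) (mul x y)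
| alg_pow_zero t : alg_pow t 0
| alg_pow_add t x y : alg_pow t x -> alg_pow t y -> alg_pow t (x + y)
| alg_pow_scale t a x : alg_pow t x -> alg_pow t (a *: x).

Definition alg_nilpotent : Prop :=
  exists2 t, (0 < t)%N & forall x, alg_pow t x -> x = 0.

End NonassociativePowers.

Section IDD.
Variable K : fieldType.
Implicit Types (k n i j : nat) (m : int).

Definition idd_coef m i : K :=
  if (m <= i%:Z)%R then i`!%:R / (`|i%:Z - m|)`!%:R else 0.

(* The underlying space, with basis e_k, ..., e_n; when k <= n it has
   dimension n - k + 1, and coordinate s is the coordinate along e_(k + s). *)
Definition idd_space k n := 'rV[K]_(n - k).+1.

(* e_d, with the convention e_d = 0 when d is not in [k, n]. *)
Definition idd_basis k n (d : int) : idd_space k n :=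
  \row_s ((k + s)%N%:Z == d)%:R.

Definition idd_mul_basis k n (m1 m2 : int) i j : idd_space k n :=
  (idd_coef m1 i * idd_coef m2 j) *: idd_basis k n (i%:Z + j%:Z - m1 - m2).

Definition idd_mul k n (m1 m2 : int) (x y : idd_space k n) : idd_space k n :=
  \sum_s \sum_t (x 0 s * y 0 t) *: idd_mul_basis k n m1 m2 (k + s) (k + t).

Definition idd_level (m1 m2 : int) : int := m1 + m2.

Lemma idd_basisE k n (s : 'I_(n - k).+1) :
  idd_basis k n (k + s)%N = delta_mx 0 s.
Proof.
by apply/rowP => t; rewrite !mxE eqxx /= eqz_nat eqn_add2l.
Qed.

Lemma idd_basis_out k n (d : int) : (k <= n)%N ->
  ~~ ((k%:Z <= d) && (d <= n%:Z))%R -> idd_basis k n d = 0.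
Proof.
move=> kn; apply: contraNeq => /eqP nz.
case: (pickP (fun s : 'I_(n - k).+1 => (k + s)%N%:Z == d)) => [s /eqP <-|no].
  by rewrite !lez_nat leq_addr -leq_subRL // -ltnS ltn_ord.
by case: nz; apply/rowP => s; rewrite !mxE no.
Qed.

Lemma idd_mul_basisE k n (m1 m2 : int) i j :
    (k <= i <= n)%N -> (k <= j <= n)%N ->
  idd_mul m1 m2 (idd_basis k n i) (idd_basis k n j)
  = (idd_coef m1 i * idd_coef m2 j) *: idd_basis k n (i%:Z + j%:Z - m1 - m2).
Proof.
move=> /andP[ki ni] /andP[kj nj].
have ltS l : (k <= l)%N -> (l <= n)%N -> (l - k < (n - k).+1)%N.
  by move=> kl ln; rewrite ltnS leq_sub2r.
rewrite /idd_mul (bigD1 (Ordinal (ltS i ki ni))) //=.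
rewrite [X in _ + X]big1 ?addr0 => [|s sP]; last first.
  rewrite big1 // => t _; rewrite !mxE eqz_nat.
  suff /negPf-> : (k + s != i)%N by rewrite mul0r scale0r.
  by apply: contra_neqN sP => /eqP E; apply/val_inj; rewrite /= -E addKn.
rewrite (bigD1 (Ordinal (ltS j kj nj))) //=.
rewrite big1 ?addr0 => [|t tP]; last first.
  rewrite !mxE !eqz_nat.
  suff /negPf-> : (k + t != j)%N by rewrite mulr0 scale0r.
  by apply: contra_neqN tP => /eqP E; apply/val_inj; rewrite /= -E addKn.
by rewrite !mxE /= !subnKC // !eqxx mulr1 scale1r.
Qed.

Lemma idd_mul_linearl k n (m1 m2 : int) (y : idd_space k n) :
  linear (fun x => idd_mul m1 m2 x y).
Proof.
move=> a x z; rewrite /idd_mul scaler_sumr -big_split; apply: eq_bigr => s _.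
rewrite scaler_sumr -big_split; apply: eq_bigr => t _ /=.
by rewrite !mxE scalerA -scalerDl mulrDl mulrA.
Qed.

Lemma idd_mul_linearr k n (m1 m2 : int) (x : idd_space k n) :
  linear (idd_mul m1 m2 x).
Proof.
move=> a y z; rewrite /idd_mul scaler_sumr -big_split; apply: eq_bigr => s _.
rewrite scaler_sumr -big_split; apply: eq_bigr => t _ /=.
by rewrite !mxE scalerA -scalerDl mulrDr mulrCA.
Qed.

End IDD.

(* Main.v *)
Require Import Defs.
From mathcomp Require Import all_boot all_order all_algebra.
From mathcomp Require Import complex reals.
From mathcomp Require Import zify.

(** Give [e_i] the weight [n + 1 - i], which lies between [1] and [n + 1 - k]
    on the basis.  With [L = m1 + m2], the product of [e_i] and [e_j] is a
    multiple of [e_(i + j - L)], whose weight exceeds the sum of the weights of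
    [e_i] and [e_j] by [L - n - 1].  The condition [n < L] says precisely that
    this excess is nonnegative, so weights are superadditive under the product.
    Hence [A^t] lies in the span of the [e_i] of weight at least [t]
    ([alg_pow_idd_weight]), which is zero as soon as [t] exceeds the largest
    weight [n + 1 - k]. *)

Import GRing.Theory.
Local Open Scope ring_scope.

(** A coordinate of a product can only come from coordinates of the factors
    whose degrees add up to its own degree plus the level. *)
Lemma idd_mul_coord_neq0 {K : fieldType} {k n : nat} {m1 m2 : int}
    {x y : idd_space K k n} {u : 'I_(n - k).+1} :
  idd_mul m1 m2 x y 0 u != 0 ->
  exists s t, [/\ x 0 s != 0, y 0 t != 0 &
    (k + u)%:Z + idd_level m1 m2 = (k + s)%:Z + (k + t)%:Z].
Proof.
rewrite /idd_mul summxE => /eqP sum_neq0.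
case: (pickP (fun s => (\sum_t (x 0 s * y 0 t) *:
    idd_mul_basis K k n m1 m2 (k + s) (k + t)) 0 u != 0)) => [s|all0]; last first.
  by case: sum_neq0; apply: big1 => s _; apply/eqP/negbFE/all0.
rewrite summxE => /eqP row_neq0.
case: (pickP (fun t => ((x 0 s * y 0 t) *:
    idd_mul_basis K k n m1 m2 (k + s) (k + t)) 0 u != 0)) => [t|all0]; last first.
  by case: row_neq0; apply: big1 => t _; apply/eqP/negbFE/all0.
rewrite !mxE !mulf_eq0 !negb_or => /andP[/andP[xs yt] /andP[_]].
have [deg_u _|_] := eqVneq (k + u)%N%:Z; last by rewrite eqxx.
by exists s, t; split=> //; rewrite deg_u /idd_level; lia.
Qed.

(** Elements of [A^t] have weight at least [t]: this holds for [t = 1] because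
    degrees are at most [n], and it passes to products because weights are
    superadditive when the level exceeds [n].  The conclusion is
    [t <= n + 1 - (k + s)] written without subtraction. *)
Lemma alg_pow_idd_weight {K : fieldType} {k n : nat} {m1 m2 : int}
    (kn : (k <= n)%N) (n_lt_level : n%:Z < idd_level m1 m2)
    (t : nat) (x : idd_space K k n) :
  alg_pow (@idd_mul K k n m1 m2) t x ->
  forall s, x 0 s != 0 -> (k + s + t <= n.+1)%N.
Proof.
elim=> {t x} [x|i j x y _ _ _ IHx _ IHy|t|t x y _ IHx _ IHy|t a x _ IHx] s.
- by move=> _; have := ltn_ord s; lia.
- move=> /idd_mul_coord_neq0[p [q [/IHx x_wt /IHy y_wt deg_s]]].
  by lia.
- by rewrite mxE eqxx.
- rewrite mxE; have [x0|/IHx //] := eqVneq (x 0 s) 0.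
  by rewrite x0 add0r => /IHy.
- by rewrite mxE mulf_eq0 negb_or => /andP[_ /IHx].
Qed.

Theorem proposition2p8 (R : realType) (k n : nat) (m1 m2 : int)
  (hkn : (k <= n)%N) (hm : m2 <= m1)
  (hnz : exists x y : idd_space R[i] k n, idd_mul m1 m2 x y <> 0)
  (hlev1 : n%:Z < idd_level m1 m2)
  (hlev2 : idd_level m1 m2 <= 2 * n%:Z - k%:Z) :
  alg_nilpotent (@idd_mul R[i] k n m1 m2).
Proof.
(* [n - k + 2] is the first integer above the largest weight [n - k + 1]. *)
exists (n - k).+2 => // x x_pow; apply/rowP => s; rewrite mxE.
by apply/eqP/negPn/negP => /(alg_pow_idd_weight hkn hlev1 _ _ x_pow); lia.
Qed.
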